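(* For every nonzero real number $x$, $$\left.\frac{\partial \mathrm{Wi}_{\alpha,\beta}(x)}{\partial\alpha}\right|_{\alpha=\beta=1}=-\gamma-\frac12\ln x\,I_0(2\sqrt x)-K_0(2\sqrt x).$$
   Context: The integral Wright function is $\mathrm{Wi}_{\alpha,\beta}(x)=\sum_{k=1}^\infty\frac{x^k}{k\,k!\,\Gamma(\alpha k+\beta)}$ (with $1/\Gamma=0$ at the poles of $\Gamma$), so that $\frac{\partial \mathrm{Wi}_{\alpha,\beta}(x)}{\partial\alpha}=-\sum_{k=1}^\infty\frac{\psi(\alpha k+\beta)}{k!\,\Gamma(\alpha k+\beta)}x^k$, with $\psi=\Gamma'/\Gamma$ the digamma function. $\gamma$ is the Euler-Mascheroni constant; $I_\nu$ and $K_\nu$ are the modified Bessel functions of the first and second kind. For $x<0$, $\ln x$ and $\sqrt x$ denote principal branches. *)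

(* Defs.v *)
From Stdlib Require Export Reals ZArith.
From Coquelicot Require Export Coquelicot.
Open Scope R_scope.

(** The Gamma function for s > 0 is Euler's integral.  Its reciprocal is then
    extended to all real s by 1/Gamma(s) = s(s+1)...(s+n-1)/Gamma(s+n) for some n
    with s + n > 0; the product contains the factor 0, hence the value is 0, exactly
    when s is a pole of Gamma. *)
Definition Gamma_pos (s : R) : R :=
  RInt_gen (fun t => Rpower t (s - 1) * exp (- t)) (at_right 0) (Rbar_locally p_infty).

Fixpoint rising (s : R) (n : nat) : R :=
  match n with
  | O => 1
  | S m => rising s m * (s + INR m)
  end.

(* [up (- s) > - s], and [Z.to_nat (up (- s)) = 0] as soon as [s > 0], so that
   [rGamma s = / Gamma_pos s] for [s > 0]. *)
Definition rGamma (s : R) : R :=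
  let n := Z.to_nat (up (- s)) in rising s n / Gamma_pos (s + INR n).

(* Shifted index: the sum over k >= 1 is a [Series] with k replaced by [S k]. *)
Definition Wi (alpha beta x : R) : R :=
  Series (fun k => x ^ (S k) / (INR (S k) * INR (fact (S k)))
                   * rGamma (alpha * INR (S k) + beta)).

Definition euler_gamma : R :=
  real (Lim_seq (fun n => sum_f_R0 (fun k => / INR (S k)) n - ln (INR (S n)))).

Definition Cexp (z : C) : C := (exp (Re z) * cos (Im z), exp (Re z) * sin (Im z)).

(** Principal branches, with argument in (-PI, PI]; meaningful for z <> 0 only. *)
Definition Carg (z : C) : R :=
  if Rlt_dec (Im z) 0 then - acos (Re z / Cmod z) else acos (Re z / Cmod z).

Definition Clog (z : C) : C := (ln (Cmod z), Carg z).

Definition Crpower (z : C) (nu : R) : C := Cexp (nu * Clog z).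

Definition Csqrt (z : C) : C := Crpower z (1 / 2).

Definition CSeries (a : nat -> C) : C := iota (fun l : C_R_CompleteNormedModule => is_series a l).

(** Modified Bessel functions of real order nu and complex argument z <> 0. *)
Definition BesselI (nu : R) (z : C) : C :=
  (Crpower (z / 2) nu
   * CSeries (fun k => (z ^ 2 / 4) ^ k * (rGamma (nu + INR k + 1) / INR (fact k))%R))%C.

Definition BesselK_quotient (nu : R) (z : C) : C :=
  ((PI / 2)%R * (BesselI (- nu) z - BesselI nu z) / sin (nu * PI))%C.

(* At integer order the quotient is 0/0, and K_nu is its limit in the order. *)
Definition BesselK (nu : R) (z : C) : C :=
  if Req_EM_T nu (IZR (Int_part nu))
  then iota (fun l : C_R_CompleteNormedModule =>
         filterlim (fun mu : R => BesselK_quotient mu z) (locally' nu) (locally l))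
  else BesselK_quotient nu z.

(* Main.v *)
Require Import Defs.
From Stdlib Require Import Lra Lia.

(** Write g for 1/Gamma and S(nu) = sum over k >= 0 of x^k g(nu + k + 1) / k!.
    Choose L with exp L = x and Im L in [0, PI], so that Clog x = L and
    (2 sqrt x / 2)^nu = exp (nu L / 2).  The Bessel series then reads
    I_nu (2 sqrt x) = exp (nu L / 2) S(nu) with S real ([BesselI_sqrt]).  The
    quotient defining K_nu tends to minus the nu-derivative of I_nu at nu = 0,
    hence K_0 (2 sqrt x) = - (L / 2 S(0) + S'(0)) ([BesselK_0_sqrt]).  On the
    right-hand side of the theorem the logarithmic terms cancel, and only
    S'(0) - gamma remains.  Differentiating S term by term gives
    S'(0) = sum over k >= 0 of x^k g'(k + 1) / k!, whose term k = 0 is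
    g'(1) = gamma; the terms k >= 1 form the alpha-derivative of Wi at
    alpha = 1, again computed term by term.

    Two facts about g carry this.

    The value g'(1) = gamma ([is_derive_rGamma_1]) is obtained without
    differentiating under the integral sign.  The function ln Gamma is convex
    and satisfies ln Gamma (s + 1) = ln Gamma s + ln s, so its slopes from n to
    points at distance at most 1 lie between ln (n - 1) and ln n.  Moving the
    point 1 to the far point n + 2 by the functional equation costs a sum of n + 1
    logarithms, whose derivative is the harmonic number; the difference
    quotient of ln Gamma at 1 is thus squeezed around ln (n + 1) - H_(n+1), where
    H_m = 1 + 1/2 + ... + 1/m.

    Termwise differentiation ([is_derive_Series]) needs a bound on difference
    quotients that is uniform in the increment.  The same slope bounds, with
    0 < g <= 2, give |g(s) - g(n)| <= 6 n |s - n| for every s > 0 and every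
    integer n >= 1 ([rGamma_lipschitz_nat]); the factor n is harmless against
    the factorials. *)

(** * The Gamma integral *)

Lemma exp_le x y : x <= y -> exp x <= exp y.
Proof.
intros [H | ->]; [now apply Rlt_le, exp_increasing | apply Rle_refl].
Qed.

Lemma exp_le_1 x : x <= 0 -> exp x <= 1.
Proof. intros H. apply exp_le in H. now rewrite exp_0 in H. Qed.

(** For a nonnegative integrand the integrals over [a, b] increase with the interval,
    so the improper integral is their supremum.  The second conclusion is what later
    gives positivity of the Gamma function. *)
Lemma is_RInt_gen_of_bounded (f : R -> R) (M : R) :
  (forall a b, 0 < a <= b -> ex_RInt f a b) ->
  (forall t, 0 < t -> 0 <= f t) ->
  (forall a b, 0 < a <= b -> RInt f a b <= M) ->
  exists L, is_RInt_gen f (at_right 0) (Rbar_locally p_infty) L /\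
    forall a b, 0 < a <= b -> RInt f a b <= L.
Proof.
intros Hex Hpos HM.
destruct (completeness (fun y => exists a b, 0 < a <= b /\ y = RInt f a b))
  as [L [Lub Lleast]].
{ exists M. intros y [a [b [Hab ->]]]. now apply HM. }
{ exists (RInt f 1 1). exists 1, 1. split; [lra | reflexivity]. }
assert (Hle : forall a b, 0 < a <= b -> RInt f a b <= L).
{ intros a b Hab. apply Lub. now exists a, b. }
assert (Hmono : forall a b a' b', 0 < a' <= a -> a <= b -> b <= b' ->
  RInt f a b <= RInt f a' b').
{ intros a b a' b' Ha Hab Hb.
  rewrite <- (RInt_Chasles f a' b b') by (apply Hex; lra).
  rewrite <- (RInt_Chasles f a' a b) by (apply Hex; lra).
  assert (0 <= RInt f a' a).
  { apply RInt_ge_0; [lra | apply Hex; lra | intros; apply Hpos; lra]. }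
  assert (0 <= RInt f b b').
  { apply RInt_ge_0; [lra | apply Hex; lra | intros; apply Hpos; lra]. }
  change plus with Rplus. lra. }
exists L. split; [ | exact Hle].
intros P [eps HP].
assert (Hap : exists a0 b0, 0 < a0 <= b0 /\ L - eps < RInt f a0 b0).
{ apply Classical_Prop.NNPP. intros Hn.
  assert (L <= L - eps); [ | destruct eps; simpl in *; lra].
  apply Lleast. intros y [a [b [Hab ->]]].
  apply Rnot_lt_le. intros Hlt. apply Hn. now exists a, b. }
destruct Hap as [a0 [b0 [Hab0 Hnear]]].
assert (Ha0 : 0 < a0) by lra.
apply Filter_prod with (Q := fun a => 0 < a < a0) (R := fun b => b0 < b).
- exists (mkposreal _ Ha0). intros y By Hy.
  change (Rabs (y - 0) < a0) in By. rewrite Rminus_0_r in By.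
  apply Rabs_def2 in By. lra.
- now exists b0.
- intros a b Ha Hb. exists (RInt f a b). split.
  + apply (RInt_correct f). simpl. apply Hex. lra.
  + apply HP. change (Rabs (RInt f a b - L) < eps).
    assert (H1 := Hmono a0 b0 a b ltac:(lra) ltac:(lra) ltac:(lra)).
    assert (H2 := Hle a b ltac:(lra)).
    apply Rabs_def1; destruct eps; simpl in *; lra.
Qed.

Definition Gamma_integrand (s t : R) : R := Rpower t (s - 1) * exp (- t).

Lemma Gamma_integrand_pos s t : 0 < Gamma_integrand s t.
Proof. apply Rmult_lt_0_compat; apply exp_pos. Qed.

Lemma continuous_Gamma_integrand s t : 0 < t -> continuous (Gamma_integrand s) t.
Proof.
intros Ht. apply (ex_derive_continuous (Gamma_integrand s)).
unfold Gamma_integrand, Rpower. auto_derive. exact Ht.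
Qed.

Lemma ex_RInt_Gamma_integrand s a b : 0 < a <= b -> ex_RInt (Gamma_integrand s) a b.
Proof.
intros Hab. apply (ex_RInt_continuous (Gamma_integrand s)).
rewrite Rmin_left, Rmax_right by lra.
intros t Ht. apply continuous_Gamma_integrand. lra.
Qed.

(** Tangent line of ln at p, applied to 1 + t: p ln (1 + t) <= t + 1 - p + p ln p. *)
Lemma exp_decay_bound (p : R) : 0 < p ->
  exists C, 0 < C /\ forall t, 0 < t -> exp (- t) <= C * Rpower (1 + t) (- p).
Proof.
intros Hp. exists (exp (1 - p + p * ln p)). split; [apply exp_pos | ].
intros t Ht. unfold Rpower. rewrite <- exp_plus. apply exp_le.
assert (Hq : 0 < (1 + t) / p) by (apply Rdiv_lt_0_compat; lra).
assert (H := exp_ineq1_le (ln ((1 + t) / p))).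
rewrite exp_ln in H by exact Hq.
rewrite ln_div in H by lra.
apply (Rmult_le_compat_l p) in H; [ | lra].
replace (p * ((1 + t) / p)) with (1 + t) in H by (field; lra).
lra.
Qed.

(** One elementary majorant works at both ends of the half-line: with the decay bound
    at exponent s + 1, the integrand is at most C t^(s-1) / (1+t)^(s+1), which is the
    derivative of C/s (t / (1+t))^s, a function with values in [0, C/s]. *)
Lemma Gamma_integral (s : R) : 0 < s ->
  is_RInt_gen (Gamma_integrand s) (at_right 0) (Rbar_locally p_infty) (Gamma_pos s) /\
  0 < Gamma_pos s.
Proof.
intros Hs.
destruct (exp_decay_bound (s + 1)) as [C [HC Hdec]]; [lra | ].
destruct (is_RInt_gen_of_bounded (Gamma_integrand s) (C / s)) as [L [HL Hle]].
- apply ex_RInt_Gamma_integrand.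
- intros t _. apply Rlt_le, Gamma_integrand_pos.
- intros a b Hab.
  (* F is the antiderivative C/s (t / (1+t))^s of the majorant h. *)
  set (F := fun t => C / s * exp (s * (ln t - ln (1 + t)))).
  set (h := fun t => C * (Rpower t (s - 1) * Rpower (1 + t) (- (s + 1)))).
  assert (HF : is_RInt h a b (F b - F a)).
  { apply (is_RInt_derive F h).
    - rewrite Rmin_left, Rmax_right by lra. intros t Ht.
      unfold F, h. auto_derive; [repeat split; lra | ].
      unfold Rpower.
      replace ((s - 1) * ln t) with (s * ln t + - ln t) by ring.
      replace (- (s + 1) * ln (1 + t)) with (- s * ln (1 + t) + - ln (1 + t)) by ring.
      replace (s * (ln t + - ln (1 + t))) with (s * ln t + - s * ln (1 + t)) by ring.
      rewrite !exp_plus, !exp_Ropp, !exp_ln by lra. field. lra.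
    - rewrite Rmin_left, Rmax_right by lra. intros t Ht.
      apply (ex_derive_continuous h). unfold h, Rpower. auto_derive.
      repeat split; lra. }
  apply Rle_trans with (F b - F a).
  + rewrite <- (is_RInt_unique _ _ _ _ HF).
    apply RInt_le; [lra | now apply ex_RInt_Gamma_integrand | now exists (F b - F a) | ].
    intros t Ht. unfold Gamma_integrand, h.
    rewrite (Rmult_comm C), Rmult_assoc.
    apply Rmult_le_compat_l; [apply Rlt_le, exp_pos | ].
    rewrite Rmult_comm. apply Hdec. lra.
  + assert (0 < C / s) by (apply Rdiv_lt_0_compat; lra).
    assert (0 < F a) by (apply Rmult_lt_0_compat; [lra | apply exp_pos]).
    assert (F b <= C / s); [ | lra].
    unfold F. rewrite <- (Rmult_1_r (C / s)) at 2.
    apply Rmult_le_compat_l; [lra | ].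
    apply exp_le_1.
    assert (ln b < ln (1 + b)) by (apply ln_increasing; lra). nra.
- replace (Gamma_pos s) with L.
  2:{ symmetry. apply is_RInt_gen_unique. exact HL. }
  split; [exact HL | ].
  apply Rlt_le_trans with (RInt (Gamma_integrand s) 1 2); [ | apply Hle; lra].
  apply RInt_gt_0; [lra | intros; apply Gamma_integrand_pos | ].
  intros t Ht. apply continuous_Gamma_integrand. lra.
Qed.

Lemma eventually_ordered :
  filter_prod (at_right 0) (Rbar_locally p_infty) (fun ab => 0 < fst ab <= snd ab).
Proof.
apply Filter_prod with (Q := fun a => 0 < a < 1) (R := fun b => 1 < b).
- exists (mkposreal 1 Rlt_0_1). intros y By Hy.
  change (Rabs (y - 0) < 1) in By. rewrite Rminus_0_r in By.
  apply Rabs_def2 in By. lra.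
- now exists 1.
- intros; simpl; lra.
Qed.

(** Fundamental theorem of calculus on the half-line, for an antiderivative that is
    only controlled on the open interval (0, +oo). *)
Lemma is_RInt_gen_derive (F f : R -> R) (la lb : R) :
  (forall t, 0 < t -> is_derive F t (f t)) ->
  (forall t, 0 < t -> continuous f t) ->
  filterlim F (at_right 0) (locally la) ->
  filterlim F (Rbar_locally p_infty) (locally lb) ->
  is_RInt_gen f (at_right 0) (Rbar_locally p_infty) (lb - la).
Proof.
intros Hd Hc Ha Hb.
apply (is_RInt_gen_ext (Derive F)).
- apply filter_imp with (2 := eventually_ordered).
  intros [a b] Hab t Ht. simpl in *. rewrite Rmin_left in Ht by lra.
  apply is_derive_unique, Hd. lra.
- apply is_RInt_gen_Derive; try assumption.
  + apply filter_imp with (2 := eventually_ordered).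
    intros [a b] Hab t Ht. simpl in *. rewrite Rmin_left in Ht by lra.
    exists (f t). apply Hd. lra.
  + apply filter_imp with (2 := eventually_ordered).
    intros [a b] Hab t Ht. simpl in *. rewrite Rmin_left in Ht by lra.
    assert (Ht0 : 0 < t) by lra.
    apply continuous_ext_loc with f; [ | now apply Hc].
    exists (mkposreal t Ht0). intros y By.
    change (Rabs (y - t) < t) in By. apply Rabs_def2 in By.
    symmetry. apply is_derive_unique, Hd. lra.
Qed.

Lemma exp_opp_lim_0 : filterlim (fun t => exp (- t)) (at_right 0) (locally 1).
Proof.
apply (filterlim_filter_le_1 (F := locally 0)); [apply filter_le_within | ].
replace 1 with (exp (- 0)) by (rewrite Ropp_0; apply exp_0).
apply (ex_derive_continuous (fun t => exp (- t))). auto_derive. exact I.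
Qed.

Lemma exp_opp_lim_infty :
  filterlim (fun t => exp (- t)) (Rbar_locally p_infty) (locally 0).
Proof.
apply (is_lim_comp exp Ropp p_infty 0 m_infty).
- apply is_lim_exp_m.
- apply (is_lim_opp (fun t => t) p_infty p_infty). apply is_lim_id.
- now exists 0.
Qed.

Lemma Gamma_pos_1 : Gamma_pos 1 = 1.
Proof.
apply is_RInt_gen_unique.
apply (is_RInt_gen_ext (fun t => exp (- t))).
{ apply filter_forall. intros ab t _.
  replace (1 - 1) with 0 by ring. unfold Rpower. rewrite Rmult_0_l, exp_0.
  symmetry. apply Rmult_1_l. }
enough (H : is_RInt_gen (fun t => exp (- t)) (at_right 0) (Rbar_locally p_infty) (- 0 - - (1))).
{ now replace (- 0 - - (1)) with 1 in H by ring. }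
apply (is_RInt_gen_derive (fun t => - exp (- t))).
- intros t Ht. auto_derive; [exact I | ring].
- intros t Ht. apply (ex_derive_continuous (fun t => exp (- t))). auto_derive. exact I.
- apply (filterlim_comp _ _ _ (fun t => exp (- t)) Ropp _ _ _ exp_opp_lim_0).
  apply (filterlim_opp (1 : R_NormedModule)).
- apply (filterlim_comp _ _ _ (fun t => exp (- t)) Ropp _ _ _ exp_opp_lim_infty).
  apply (filterlim_opp (0 : R_NormedModule)).
Qed.

(** Integration by parts: t^s e^-t - s t^(s-1) e^-t is the derivative of
    - t^s e^-t, which vanishes at both ends. *)
Lemma Gamma_pos_succ s : 0 < s -> Gamma_pos (s + 1) = s * Gamma_pos s.
Proof.
intros Hs.
destruct (Gamma_integral s Hs) as [Is _].
destruct (Gamma_integral (s + 1)) as [Is1 _]; [lra | ].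
assert (Hparts := is_RInt_gen_minus _ _ _ _ Is1 (is_RInt_gen_scal _ s _ Is)).
enough (H0 : is_RInt_gen (fun t => Gamma_integrand (s + 1) t - s * Gamma_integrand s t)
  (at_right 0) (Rbar_locally p_infty) (- 0 - - 0)).
{ assert (E : Gamma_pos (s + 1) - s * Gamma_pos s = - 0 - - 0).
  { apply (eq_trans (eq_sym (is_RInt_gen_unique (V := R_CompleteNormedModule) _ _ Hparts))).
    apply is_RInt_gen_unique. exact H0. }
  lra. }
destruct (exp_decay_bound (s + 1)) as [C [HC Hdec]]; [lra | ].
apply (is_RInt_gen_derive (fun t => - (Rpower t s * exp (- t)))).
- intros t Ht. unfold Gamma_integrand, Rpower. auto_derive; [lra | ].
  replace ((s - 1) * ln t) with (s * ln t + - ln t) by ring.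
  replace (s + 1 - 1) with s by ring.
  rewrite exp_plus, !exp_Ropp, exp_ln by lra. field. split; [apply Rgt_not_eq, exp_pos | lra].
- intros t Ht.
  apply (ex_derive_continuous (fun t => Gamma_integrand (s + 1) t - s * Gamma_integrand s t)).
  unfold Gamma_integrand, Rpower. auto_derive. repeat split; lra.
- apply (filterlim_comp _ _ _ (fun t => Rpower t s * exp (- t)) Ropp _ (locally 0));
    [ | apply (filterlim_opp (0 : R_NormedModule))].
  apply (filterlim_le_le (fun _ => 0) _ (fun t => Rpower t s) 0).
  + exists (mkposreal 1 Rlt_0_1). intros t _ Ht. split.
    * apply Rlt_le, Rmult_lt_0_compat; apply exp_pos.
    * rewrite <- (Rmult_1_r (Rpower t s)) at 2.
      apply Rmult_le_compat_l; [apply Rlt_le, exp_pos | ].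
      apply exp_le_1. lra.
  + apply filterlim_const.
  + unfold Rpower.
    apply (filterlim_comp _ _ _ (fun t => s * ln t) exp _ (Rbar_locally m_infty));
      [ | apply is_lim_exp_m].
    apply (filterlim_comp _ _ _ ln (Rmult s) _ (Rbar_locally m_infty)).
    * apply is_lim_ln_0.
    * generalize (filterlim_Rbar_mult_l s m_infty). simpl.
      destruct (Rle_dec 0 s) as [r | ]; [ | lra].
      destruct (Rle_lt_or_eq_dec 0 s r); [easy | lra].
- apply (filterlim_comp _ _ _ (fun t => Rpower t s * exp (- t)) Ropp _ (locally 0));
    [ | apply (filterlim_opp (0 : R_NormedModule))].
  apply (filterlim_le_le (fun _ => 0) _ (fun t => C * / t) 0).
  + exists 0. intros t Ht. split.
    * apply Rlt_le, Rmult_lt_0_compat; apply exp_pos.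
    * apply Rle_trans with (Rpower t s * (C * Rpower (1 + t) (- (s + 1)))).
      { apply Rmult_le_compat_l; [apply Rlt_le, exp_pos | now apply Hdec]. }
      apply Rle_trans with (C * (Rpower t s * Rpower t (- (s + 1)))).
      { rewrite <- Rmult_assoc, (Rmult_comm _ C), Rmult_assoc.
        apply Rmult_le_compat_l; [lra | ].
        apply Rmult_le_compat_l; [apply Rlt_le, exp_pos | ].
        unfold Rpower. apply exp_le.
        assert (ln t < ln (1 + t)) by (apply ln_increasing; lra). nra. }
      rewrite <- Rpower_plus. replace (s + - (s + 1)) with (- (1)) by ring.
      rewrite Rpower_Ropp, Rpower_1 by lra. lra.
  + apply filterlim_const.
  + replace (Finite 0) with (Rbar_mult C 0) by (simpl; f_equal; ring).
    apply (is_lim_scal_l Rinv C p_infty 0).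
    apply (is_lim_inv (fun t => t) p_infty p_infty); [apply is_lim_id | discriminate].
Qed.

(** * Convexity of ln Gamma and its derivative at 1 *)

Definition ln_Gamma (s : R) : R := ln (Gamma_pos s).

(** Weighted sum of the inequalities placing exp above its tangent at p x + q y. *)
Lemma exp_convex x y p q : 0 <= p -> 0 <= q -> p + q = 1 ->
  exp (p * x + q * y) <= p * exp x + q * exp y.
Proof.
intros Hp Hq Hpq. set (m := p * x + q * y).
assert (Htan : forall u, exp m * (1 + (u - m)) <= exp u).
{ intros u. replace (exp u) with (exp m * exp (u - m)).
  - apply Rmult_le_compat_l; [apply Rlt_le, exp_pos | apply exp_ineq1_le].
  - rewrite <- exp_plus. f_equal. ring. }
replace (exp m) with (p * (exp m * (1 + (x - m))) + q * (exp m * (1 + (y - m)))).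
- apply Rplus_le_compat; apply Rmult_le_compat_l; auto.
- assert (Eq : q = 1 - p) by lra. unfold m. rewrite Eq. ring.
Qed.

(** Hoelder's inequality for the Gamma integral: after dividing the integrands at x and
    z by their integrals, the integrand at y is their weighted geometric mean up to the
    constant G, and the weighted arithmetic mean integrates to G. *)
Lemma ln_Gamma_convex x y z : 0 < x -> x <= y <= z -> x < z ->
  (z - x) * ln_Gamma y <= (z - y) * ln_Gamma x + (y - x) * ln_Gamma z.
Proof.
intros Hx Hy Hxz.
set (p := (z - y) / (z - x)). set (q := (y - x) / (z - x)).
assert (Hp : 0 <= p) by (apply Rdiv_le_0_compat; lra).
assert (Hq : 0 <= q) by (apply Rdiv_le_0_compat; lra).
assert (Hpq : p + q = 1) by (unfold p, q; field; lra).
assert (Ey : y = p * x + q * z) by (unfold p, q; field; lra).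
destruct (Gamma_integral x) as [Ix Px]; [lra | ].
destruct (Gamma_integral y) as [Iy Py]; [lra | ].
destruct (Gamma_integral z) as [Iz Pz]; [lra | ].
set (G := exp (p * ln_Gamma x + q * ln_Gamma z)).
assert (Hpt : forall t, Gamma_integrand y t <=
  G * p / Gamma_pos x * Gamma_integrand x t + G * q / Gamma_pos z * Gamma_integrand z t).
{ intros t.
  assert (E : forall s, 0 < Gamma_pos s ->
    Gamma_integrand s t / Gamma_pos s = exp ((s - 1) * ln t - t - ln_Gamma s)).
  { intros s Ps. unfold Gamma_integrand, Rpower, ln_Gamma, Rdiv.
    replace (/ Gamma_pos s) with (exp (- ln (Gamma_pos s)))
      by (rewrite exp_Ropp, exp_ln; auto).
    rewrite <- !exp_plus. reflexivity. }
  replace (Gamma_integrand y t) with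
    (G * exp (p * ((x - 1) * ln t - t - ln_Gamma x)
              + q * ((z - 1) * ln t - t - ln_Gamma z))).
  - replace (G * p / Gamma_pos x * Gamma_integrand x t
             + G * q / Gamma_pos z * Gamma_integrand z t) with
      (G * (p * (Gamma_integrand x t / Gamma_pos x)
            + q * (Gamma_integrand z t / Gamma_pos z))) by (field; lra).
    apply Rmult_le_compat_l; [apply Rlt_le, exp_pos | ].
    rewrite !E by assumption. now apply exp_convex.
  - unfold G, Gamma_integrand, Rpower. rewrite <- !exp_plus. f_equal.
    rewrite Ey. replace q with (1 - p) by lra. ring. }
assert (Hle : Gamma_pos y <= G).
{ apply Rle_trans with (norm (Gamma_pos y)); [apply Rle_abs | ].
  apply (RInt_gen_norm (V := R_CompleteNormedModule) (Fa := at_right 0)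
    (Fb := Rbar_locally p_infty) (Gamma_integrand y)
    (fun t => G * p / Gamma_pos x * Gamma_integrand x t
              + G * q / Gamma_pos z * Gamma_integrand z t)).
  - apply filter_imp with (2 := eventually_ordered). tauto.
  - apply filter_forall. intros ab t _.
    change (Rabs (Gamma_integrand y t) <= G * p / Gamma_pos x * Gamma_integrand x t
              + G * q / Gamma_pos z * Gamma_integrand z t).
    rewrite Rabs_pos_eq by apply Rlt_le, Gamma_integrand_pos. apply Hpt.
  - exact Iy.
  - assert (IG : is_RInt_gen (fun t => G * p / Gamma_pos x * Gamma_integrand x t
                                       + G * q / Gamma_pos z * Gamma_integrand z t)
      (at_right 0) (Rbar_locally p_infty)
      (G * p / Gamma_pos x * Gamma_pos x + G * q / Gamma_pos z * Gamma_pos z)).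
    { apply (is_RInt_gen_plus (fun t => G * p / Gamma_pos x * Gamma_integrand x t)
        (fun t => G * q / Gamma_pos z * Gamma_integrand z t)).
      - apply (is_RInt_gen_scal (Gamma_integrand x) (G * p / Gamma_pos x)). exact Ix.
      - apply (is_RInt_gen_scal (Gamma_integrand z) (G * q / Gamma_pos z)). exact Iz. }
    replace (G * p / Gamma_pos x * Gamma_pos x + G * q / Gamma_pos z * Gamma_pos z)
      with (G * (p + q)) in IG by (field; lra).
    rewrite Hpq, Rmult_1_r in IG. exact IG. }
assert (Hln : ln_Gamma y <= p * ln_Gamma x + q * ln_Gamma z).
{ rewrite <- (ln_exp (p * ln_Gamma x + q * ln_Gamma z)). now apply ln_le. }
apply (Rmult_le_compat_l (z - x)) in Hln; [ | lra].
replace ((z - x) * (p * ln_Gamma x + q * ln_Gamma z)) with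
  ((z - y) * ln_Gamma x + (y - x) * ln_Gamma z) in Hln; [exact Hln | ].
unfold p, q. field. lra.
Qed.

Lemma ln_Gamma_succ s : 0 < s -> ln_Gamma (s + 1) = ln_Gamma s + ln s.
Proof.
intros Hs. unfold ln_Gamma. rewrite Gamma_pos_succ by exact Hs.
rewrite ln_mult; [ring | exact Hs | now apply Gamma_integral].
Qed.

Lemma ln_Gamma_1 : ln_Gamma 1 = 0.
Proof. unfold ln_Gamma. rewrite Gamma_pos_1. apply ln_1. Qed.

(** By convexity the slope of ln Gamma from a to s lies between those over [a-1, a] and
    [a, a+1], which the functional equation evaluates to ln (a-1) and ln a. *)
Lemma ln_Gamma_slope_right a s : 1 < a -> a <= s <= a + 1 ->
  (s - a) * ln (a - 1) <= ln_Gamma s - ln_Gamma a <= (s - a) * ln a.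
Proof.
intros Ha Hs.
assert (E1 := ln_Gamma_succ a ltac:(lra)).
assert (E2 := ln_Gamma_succ (a - 1) ltac:(lra)).
replace (a - 1 + 1) with a in E2 by ring.
assert (H1 := ln_Gamma_convex (a - 1) a s ltac:(lra) ltac:(lra) ltac:(lra)).
assert (H2 := ln_Gamma_convex a s (a + 1) ltac:(lra) ltac:(lra) ltac:(lra)).
rewrite E1 in H2.
replace (ln_Gamma (a - 1)) with (ln_Gamma a - ln (a - 1)) in H1 by lra.
split; nra.
Qed.

Lemma ln_Gamma_slope_left a s : 1 < a -> a - 1 <= s <= a ->
  (a - s) * ln (a - 1) <= ln_Gamma a - ln_Gamma s <= (a - s) * ln a.
Proof.
intros Ha Hs.
assert (E1 := ln_Gamma_succ a ltac:(lra)).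
assert (E2 := ln_Gamma_succ (a - 1) ltac:(lra)).
replace (a - 1 + 1) with a in E2 by ring.
assert (H1 := ln_Gamma_convex (a - 1) s a ltac:(lra) ltac:(lra) ltac:(lra)).
assert (H2 := ln_Gamma_convex s a (a + 1) ltac:(lra) ltac:(lra) ltac:(lra)).
rewrite E1 in H2.
replace (ln_Gamma (a - 1)) with (ln_Gamma a - ln (a - 1)) in H1 by lra.
split; nra.
Qed.

(** Since ln Gamma vanishes at 1 and 2, convexity makes it nonnegative outside (1, 2);
    on [1, 2] it lies above the line through (2, 0) and (3, ln 2). *)
Lemma ln_Gamma_lower_bound s : 0 < s -> - ln 2 <= ln_Gamma s.
Proof.
intros Hs.
assert (E1 := ln_Gamma_1).
assert (E2 : ln_Gamma 2 = 0).
{ replace 2 with (1 + 1) by ring. rewrite ln_Gamma_succ, E1, ln_1; lra. }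
assert (E3 : ln_Gamma 3 = ln 2).
{ replace 3 with (2 + 1) by ring. rewrite ln_Gamma_succ, E2; lra. }
assert (H2 : 0 < ln 2) by (rewrite <- ln_1; apply ln_increasing; lra).
destruct (Rlt_dec s 1).
{ assert (H := ln_Gamma_convex s 1 2 ltac:(lra) ltac:(lra) ltac:(lra)). nra. }
destruct (Rlt_dec 2 s).
{ assert (H := ln_Gamma_convex 1 2 s ltac:(lra) ltac:(lra) ltac:(lra)). nra. }
assert (H := ln_Gamma_convex s 2 3 ltac:(lra) ltac:(lra) ltac:(lra)). nra.
Qed.

(** First-order expansion without division by the increment: this form is stable under
    sums and allows h = 0. *)
Lemma is_derive_iff (f : R -> R) (x l : R) :
  is_derive f x l <->
  forall eps, 0 < eps -> exists delta, 0 < delta /\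
    forall h, Rabs h < delta -> Rabs (f (x + h) - f x - h * l) <= eps * Rabs h.
Proof.
rewrite is_derive_Reals. split; intros H eps Heps.
- destruct (H eps Heps) as [delta Hd]. exists delta. split; [apply cond_pos | ].
  intros h Hh. destruct (Req_dec h 0) as [-> | Hn].
  + rewrite Rplus_0_r, Rabs_R0. replace (f x - f x - 0 * l) with 0 by ring.
    rewrite Rabs_R0. lra.
  + replace (f (x + h) - f x - h * l) with (((f (x + h) - f x) / h - l) * h)
      by (field; exact Hn).
    rewrite Rabs_mult. apply Rmult_le_compat_r; [apply Rabs_pos | ].
    apply Rlt_le. now apply Hd.
- destruct (H (eps / 2) ltac:(lra)) as [delta [Hd0 Hd]].
  exists (mkposreal delta Hd0). intros h Hn Hh. simpl in Hh.
  specialize (Hd h Hh). assert (0 < Rabs h) by now apply Rabs_pos_lt.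
  apply Rle_lt_trans with (eps / 2); [ | lra].
  apply Rmult_le_reg_r with (Rabs h); [assumption | ].
  rewrite <- Rabs_mult.
  replace (((f (x + h) - f x) / h - l) * h) with (f (x + h) - f x - h * l)
    by (field; exact Hn). exact Hd.
Qed.

Lemma ln_le_minus_1 y : 0 < y -> ln y <= y - 1.
Proof.
intros Hy. assert (H := exp_ineq1_le (ln y)). rewrite exp_ln in H; lra.
Qed.

Lemma ln_succ_diff_bounds n :
  / INR (S (S n)) <= ln (INR (S (S n))) - ln (INR (S n)) <= / INR (S n).
Proof.
assert (Hn : 0 < INR (S n)) by (apply lt_0_INR; lia).
rewrite (S_INR (S n)). split.
- assert (H := ln_le_minus_1 (INR (S n) / (INR (S n) + 1))
    ltac:(apply Rdiv_lt_0_compat; lra)).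
  rewrite ln_div in H by lra.
  replace (INR (S n) / (INR (S n) + 1) - 1) with (- / (INR (S n) + 1)) in H by (field; lra).
  lra.
- assert (H := ln_le_minus_1 ((INR (S n) + 1) / INR (S n))
    ltac:(apply Rdiv_lt_0_compat; lra)).
  rewrite ln_div in H by lra.
  replace ((INR (S n) + 1) / INR (S n) - 1) with (/ INR (S n)) in H by (field; lra).
  lra.
Qed.

Definition harmonic (n : nat) : R := sum_f_R0 (fun k => / INR (S k)) n.

(** The increment ln (n+2) - ln (n+1) lies between 1/(n+2) and 1/(n+1): the lower bound
    makes the sequence decrease, the upper one keeps it nonnegative, so that
    [euler_gamma] is an actual limit. *)
Lemma is_lim_seq_euler_gamma :
  is_lim_seq (fun n => harmonic n - ln (INR (S n))) euler_gamma.
Proof.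
apply Lim_seq_correct'.
apply ex_finite_lim_seq_decr with 0.
- intros n. unfold harmonic. rewrite tech5.
  assert (H := ln_succ_diff_bounds n). lra.
- intros n.
  enough (ln (INR (S (S n))) <= harmonic n).
  { assert (H1 := ln_succ_diff_bounds n).
    assert (0 < / INR (S (S n))) by (apply Rinv_0_lt_compat, lt_0_INR; lia). lra. }
  induction n as [ | n IH].
  + assert (H := ln_le_minus_1 2 ltac:(lra)). unfold harmonic. simpl.
    replace (1 + 1) with 2 by ring. lra.
  + unfold harmonic in *. rewrite tech5.
    assert (H := ln_succ_diff_bounds (S n)). lra.
Qed.

Lemma ln_Gamma_add_nat s n : 0 < s ->
  ln_Gamma (s + INR (S n)) = ln_Gamma s + sum_f_R0 (fun j => ln (s + INR j)) n.
Proof.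
intros Hs. induction n as [ | n IH].
- simpl. rewrite Rplus_0_r. now apply ln_Gamma_succ.
- rewrite (S_INR (S n)), <- Rplus_assoc, ln_Gamma_succ, IH, tech5; [ring | ].
  assert (0 <= INR (S n)) by apply pos_INR. lra.
Qed.

(** Shift by n + 1 with the functional equation: the error splits into the slope error
    of ln Gamma near n + 2, the first-order error of a finite sum of logarithms whose
    derivative is the harmonic number, and h times the error of the sequence that
    defines gamma.  Each is at most a third of eps |h|. *)
Lemma is_derive_ln_Gamma_1 : is_derive ln_Gamma 1 (- euler_gamma).
Proof.
apply is_derive_iff. intros eps Heps.
assert (Hlim := is_lim_seq_euler_gamma). apply is_lim_seq_spec in Hlim.
destruct (Hlim (mkposreal (eps / 3) ltac:(lra))) as [N1 H1].
(* Beyond N2 the slopes ln (n+1) and ln (n+2) differ by less than eps / 3. *)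
destruct (nfloor_ex (3 / eps)) as [N2 [_ HN2]].
{ apply Rdiv_le_0_compat; lra. }
set (n := Nat.max N1 N2).
assert (Hn1 : Rabs (harmonic n - ln (INR (S n)) - euler_gamma) < eps / 3).
{ apply (H1 n). lia. }
clear H1 Hlim.
assert (Hgap : / INR (S n) < eps / 3).
{ assert (INR N2 + 1 <= INR (S n)) by (rewrite <- S_INR; apply le_INR; lia).
  assert (0 < 3 / eps) by (apply Rdiv_lt_0_compat; lra).
  replace (eps / 3) with (/ (3 / eps)) by (field; lra).
  apply Rinv_lt_contravar; [ | lra]. apply Rmult_lt_0_compat; lra. }
assert (Hl := ln_succ_diff_bounds n).
assert (Hpos : 0 < / INR (S (S n))) by (apply Rinv_0_lt_compat, lt_0_INR; lia).
set (P := fun s => sum_f_R0 (fun j => ln (s + INR j)) n).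
assert (HP : is_derive P 1 (harmonic n)).
{ unfold P, harmonic.
  apply (is_derive_ext (fun s => sum_n (fun j => ln (s + INR j)) n)).
  { intros s. apply sum_n_Reals. }
  rewrite <- sum_n_Reals.
  apply (is_derive_sum_n (fun j s => ln (s + INR j))).
  intros k _. rewrite S_INR. assert (0 <= INR k) by apply pos_INR.
  auto_derive; [lra | field; lra]. }
apply is_derive_iff with (eps := eps / 3) in HP; [ | lra].
destruct HP as [delta [Hd0 Hd]].
exists (Rmin delta 1). split; [apply Rmin_pos; lra | ].
intros h Hh.
assert (Hhd := Rlt_le_trans _ _ _ Hh (Rmin_l _ _)).
assert (Hh1 := Rlt_le_trans _ _ _ Hh (Rmin_r _ _)).
specialize (Hd h Hhd).
assert (Hh1' := Rabs_def2 _ _ Hh1).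
assert (E1 := ln_Gamma_add_nat (1 + h) n ltac:(lra)).
assert (E2 := ln_Gamma_add_nat 1 n ltac:(lra)).
fold (P (1 + h)) in E1. fold (P 1) in E2.
assert (Ha : 1 < 1 + INR (S n)) by (assert (0 < INR (S n)) by (apply lt_0_INR; lia); lra).
assert (Hslope : Rabs (ln_Gamma (1 + h + INR (S n)) - ln_Gamma (1 + INR (S n))
  - h * ln (INR (S n))) <= eps / 3 * Rabs h).
{ assert (Ea : 1 + INR (S n) - 1 = INR (S n)) by ring.
  assert (Ea' : 1 + INR (S n) = INR (S (S n))) by (rewrite (S_INR (S n)); ring).
  destruct (Rle_dec 0 h) as [Hh0 | Hh0].
  - rewrite (Rabs_pos_eq h) by exact Hh0.
    assert (H := ln_Gamma_slope_right (1 + INR (S n)) (1 + h + INR (S n)) Ha ltac:(lra)).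
    rewrite Ea in H. rewrite Ea' in *.
    replace (1 + h + INR (S n) - INR (S (S n))) with h in H by lra.
    apply Rabs_le. nra.
  - rewrite (Rabs_left h) by lra.
    assert (H := ln_Gamma_slope_left (1 + INR (S n)) (1 + h + INR (S n)) Ha ltac:(lra)).
    rewrite Ea in H. rewrite Ea' in *.
    replace (INR (S (S n)) - (1 + h + INR (S n))) with (- h) in H by lra.
    apply Rabs_le. nra. }
replace (ln_Gamma (1 + h) - ln_Gamma 1 - h * - euler_gamma) with
  ((ln_Gamma (1 + h + INR (S n)) - ln_Gamma (1 + INR (S n)) - h * ln (INR (S n)))
   + - (P (1 + h) - P 1 - h * harmonic n)
   + - (h * (harmonic n - ln (INR (S n)) - euler_gamma))) by (rewrite E1, E2; ring).
eapply Rle_trans; [apply Rabs_triang | ].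
eapply Rle_trans; [apply Rplus_le_compat_r, Rabs_triang | ].
rewrite !Rabs_Ropp, Rabs_mult.
assert (Hg := Rmult_le_compat_l _ _ _ (Rabs_pos h) (Rlt_le _ _ Hn1)). lra.
Qed.

Lemma rGamma_pos s : 0 < s -> rGamma s = exp (- ln_Gamma s).
Proof.
intros Hs. unfold rGamma.
replace (Z.to_nat (up (- s))) with O.
- simpl. rewrite Rplus_0_r. unfold ln_Gamma.
  rewrite exp_Ropp, exp_ln by (now apply Gamma_integral). lra.
- destruct (archimed (- s)) as [_ H].
  assert (Hup : (up (- s) < 1)%Z) by (apply lt_IZR; lra). lia.
Qed.

Lemma rGamma_succ s : 0 < s -> rGamma (s + 1) = rGamma s / s.
Proof.
intros Hs. rewrite !rGamma_pos, ln_Gamma_succ by lra.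
rewrite Ropp_plus_distr, exp_plus, (exp_Ropp (ln s)), exp_ln by exact Hs. reflexivity.
Qed.

Lemma is_derive_rGamma_1 : is_derive rGamma 1 euler_gamma.
Proof.
apply (is_derive_ext_loc (fun s => exp (- ln_Gamma s))).
{ exists (mkposreal 1 Rlt_0_1). intros s Bs. change (Rabs (s - 1) < 1) in Bs.
  apply Rabs_def2 in Bs. symmetry. apply rGamma_pos. lra. }
assert (H := is_derive_ln_Gamma_1).
assert (Ex : ex_derive ln_Gamma 1) by (eexists; exact H).
auto_derive; [exact Ex | ].
replace (Derive (fun s : R => ln_Gamma s) 1) with (- euler_gamma)
  by (symmetry; apply is_derive_unique; exact H).
rewrite ln_Gamma_1, Ropp_0, exp_0. ring.
Qed.

Lemma ex_derive_rGamma_nat n : ex_derive rGamma (INR (S n)).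
Proof.
induction n as [ | n IH].
{ exists euler_gamma. apply is_derive_rGamma_1. }
assert (Hn : 0 < INR (S n)) by (apply lt_0_INR; lia).
rewrite S_INR.
apply (ex_derive_ext_loc (fun s => rGamma (s - 1) / (s - 1))).
{ exists (mkposreal _ Hn). intros s Bs.
  change (Rabs (s - (INR (S n) + 1)) < INR (S n)) in Bs.
  apply Rabs_def2 in Bs. rewrite <- rGamma_succ by lra. f_equal. ring. }
auto_derive. replace (INR (S n) + 1 + - (1)) with (INR (S n)) by ring.
repeat split; [exact IH | lra].
Qed.

Lemma rGamma_bounds s : 0 < s -> 0 < rGamma s <= 2.
Proof.
intros Hs. rewrite rGamma_pos by exact Hs. split; [apply exp_pos | ].
rewrite <- (exp_ln 2) by lra. apply exp_le.
assert (H := ln_Gamma_lower_bound s Hs). lra.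
Qed.

(** If |s - a| <= 1, the slope bounds make ln Gamma Lipschitz with constant ln a <= a,
    and exp (- u) has Lipschitz constant 2 where its values are at most 2.  If
    |s - a| > 1, it suffices that both values lie in (0, 2]. *)
Lemma rGamma_lipschitz_ge_2 a s : 2 <= a -> 0 < s ->
  Rabs (rGamma s - rGamma a) <= 2 * a * Rabs (s - a).
Proof.
intros Ha Hs.
assert (Ba := rGamma_bounds a ltac:(lra)). assert (Bs := rGamma_bounds s Hs).
destruct (Rle_dec (Rabs (s - a)) 1) as [Hn | Hn].
- apply Rabs_le_between in Hn.
  assert (Hln1 : 0 <= ln (a - 1)) by (rewrite <- ln_1; apply ln_le; lra).
  assert (Hln2 : ln a <= a) by (assert (H := ln_le_minus_1 a ltac:(lra)); lra).
  assert (Hf : Rabs (ln_Gamma s - ln_Gamma a) <= a * Rabs (s - a)).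
  { destruct (Rle_dec a s) as [Has | Has].
    - assert (H := ln_Gamma_slope_right a s ltac:(lra) ltac:(lra)).
      rewrite (Rabs_pos_eq (s - a)) by lra. apply Rabs_le. nra.
    - assert (H := ln_Gamma_slope_left a s ltac:(lra) ltac:(lra)).
      rewrite (Rabs_left (s - a)) by lra. apply Rabs_le. nra. }
  (* From exp w >= 1 + w with w = ln Gamma u - ln Gamma v. *)
  assert (Htan : forall u v, 0 < u -> 0 < v ->
    rGamma u - rGamma v <= 2 * Rabs (ln_Gamma u - ln_Gamma v)).
  { intros u v Hu Hv. assert (Bu := rGamma_bounds u Hu).
    assert (E : rGamma v = rGamma u * exp (ln_Gamma u - ln_Gamma v)).
    { rewrite !rGamma_pos, <- exp_plus by assumption. f_equal. ring. }
    assert (H := exp_ineq1_le (ln_Gamma u - ln_Gamma v)).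
    assert (H' := Rle_abs (- (ln_Gamma u - ln_Gamma v))). rewrite Rabs_Ropp in H'.
    assert (H0 := Rabs_pos (ln_Gamma u - ln_Gamma v)).
    rewrite E. nra. }
  assert (H1 := Htan s a Hs ltac:(lra)). assert (H2 := Htan a s ltac:(lra) Hs).
  rewrite (Rabs_minus_sym (ln_Gamma a)) in H2.
  apply Rabs_le. lra.
- apply Rle_trans with 2; [apply Rabs_le; lra | ]. nra.
Qed.

(** At 1 the lower slope bound ln (a - 1) is lost, so the estimate is pulled back
    from 2 by 1/Gamma(s) = s/Gamma(s + 1). *)
Lemma rGamma_lipschitz_nat n s : 0 < s ->
  Rabs (rGamma s - rGamma (INR (S n))) <= 6 * INR (S n) * Rabs (s - INR (S n)).
Proof.
intros Hs. assert (H0 := Rabs_pos (s - INR (S n))).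
destruct n as [ | n].
- simpl in *.
  assert (E1 := rGamma_succ s Hs). assert (E2 := rGamma_succ 1 ltac:(lra)).
  replace (1 + 1) with 2 in E2 by ring.
  assert (H := rGamma_lipschitz_ge_2 2 (s + 1) ltac:(lra) ltac:(lra)).
  assert (B := rGamma_bounds (s + 1) ltac:(lra)).
  replace (rGamma s - rGamma 1) with
    ((s - 1) * rGamma (s + 1) + (rGamma (s + 1) - rGamma 2))
    by (rewrite E1, E2; field; lra).
  eapply Rle_trans; [apply Rabs_triang | ].
  rewrite Rabs_mult, (Rabs_pos_eq (rGamma (s + 1))) by lra.
  replace (s + 1 - 2) with (s - 1) in H by ring. nra.
- assert (2 <= INR (S (S n))).
  { rewrite !S_INR. assert (0 <= INR n) by apply pos_INR. lra. }
  eapply Rle_trans; [now apply rGamma_lipschitz_ge_2 | ].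
  apply Rmult_le_compat_r; lra.
Qed.

(** * Termwise differentiation of the two series *)

Lemma ex_series_Rabs_le (a b : nat -> R) :
  (forall n, Rabs (a n) <= b n) -> ex_series b -> ex_series a.
Proof. apply (ex_series_le (V := R_CompleteNormedModule)). Qed.

Lemma Series_abs_le (a b : nat -> R) :
  (forall n, Rabs (a n) <= b n) -> ex_series b -> Rabs (Series a) <= Series b.
Proof.
intros H Hb. eapply Rle_trans.
- apply Series_Rabs. apply (ex_series_Rabs_le _ b); [ | exact Hb].
  intros n. rewrite Rabs_Rabsolu. apply H.
- apply Series_le; [ | exact Hb]. intros n. split; [apply Rabs_pos | apply H].
Qed.

(** A Lipschitz bound at x passes to the derivative; it supplies the summability of the
    series of derivatives. *)
Lemma is_derive_abs_le (f : R -> R) (x l M delta : R) :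
  0 < delta -> is_derive f x l ->
  (forall h, Rabs h < delta -> Rabs (f (x + h) - f x) <= M * Rabs h) ->
  Rabs l <= M.
Proof.
intros Hdelta Hf HM. apply le_epsilon. intros eps Heps.
destruct (proj1 (is_derive_iff f x l) Hf eps Heps) as [d [Hd0 Hd]].
set (h := Rmin d delta / 2).
assert (Hm : 0 < Rmin d delta) by now apply Rmin_pos.
assert (Hl := Rmin_l d delta). assert (Hr := Rmin_r d delta).
assert (Hh : 0 < h) by (unfold h; lra).
assert (Hh' : h < Rmin d delta) by (unfold h; lra).
specialize (Hd h). specialize (HM h).
rewrite (Rabs_pos_eq h) in Hd, HM by lra.
specialize (Hd ltac:(lra)). specialize (HM ltac:(lra)).
apply Rmult_le_reg_l with h; [exact Hh | ].
rewrite <- (Rabs_pos_eq h) at 1 by lra. rewrite <- Rabs_mult.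
replace (h * l) with ((f (x + h) - f x) + - (f (x + h) - f x - h * l)) by ring.
eapply Rle_trans; [apply Rabs_triang | ]. rewrite Rabs_Ropp. lra.
Qed.

(** Dominated convergence for the difference quotients: a finite head is differentiable,
    and the tail of the first-order error is at most 2 |h| times the tail of the series
    of M. *)
Lemma is_derive_Series (a : nat -> R -> R) (d M : nat -> R) (x delta : R) :
  0 < delta ->
  (forall k, is_derive (a k) x (d k)) ->
  (forall k h, Rabs h < delta -> Rabs (a k (x + h) - a k x) <= M k * Rabs h) ->
  ex_series M ->
  ex_series (fun k => a k x) ->
  ex_series d /\ is_derive (fun y => Series (fun k => a k y)) x (Series d).
Proof.
intros Hdelta Hd HM HsM Hsa.
assert (HdM : forall k, Rabs (d k) <= M k).
{ intros k. apply (is_derive_abs_le (a k) x _ _ delta); auto. }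
assert (Hsd : ex_series d) by (now apply ex_series_Rabs_le with M).
split; [exact Hsd | ].
apply is_derive_iff. intros eps Heps.
(* The tail bound 2 |h| eps / 4 leaves eps / 2 for the head. *)
assert (Htail : exists N, Series (fun k => M (S N + k)%nat) <= eps / 4).
{ assert (HL := Series_correct _ HsM). unfold is_series in HL.
  assert (HL' : is_lim_seq (sum_n M) (Series M)) by exact HL.
  apply is_lim_seq_spec in HL'.
  destruct (HL' (mkposreal (eps / 4) ltac:(lra))) as [N HN].
  exists N. specialize (HN N (le_n N)). simpl pos in HN.
  rewrite sum_n_Reals in HN.
  assert (E := Series_incr_n M (S N) ltac:(lia) HsM). simpl Nat.pred in E.
  apply Rabs_def2 in HN. lra. }
destruct Htail as [N HN].
assert (Hhead : is_derive (fun y => sum_f_R0 (fun k => a k y) N) x (sum_f_R0 d N)).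
{ apply (is_derive_ext (fun y => sum_n (fun k => a k y) N)).
  { intros y. apply sum_n_Reals. }
  rewrite <- sum_n_Reals. apply (is_derive_sum_n a). intros k _. apply Hd. }
destruct (proj1 (is_derive_iff _ _ _) Hhead (eps / 2) ltac:(lra)) as [delta' [Hd'0 Hd']].
exists (Rmin delta delta'). split; [now apply Rmin_pos | ].
intros h Hh.
assert (Hh1 := Rlt_le_trans _ _ _ Hh (Rmin_l _ _)).
assert (Hh2 := Rlt_le_trans _ _ _ Hh (Rmin_r _ _)).
specialize (Hd' h Hh2).
assert (Hdiff : ex_series (fun k => a k (x + h) - a k x)).
{ apply ex_series_Rabs_le with (fun k => M k * Rabs h).
  - intros k. now apply HM.
  - now apply ex_series_scal_r. }
assert (Hsh : ex_series (fun k => a k (x + h))).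
{ apply (ex_series_ext (fun k => (a k (x + h) - a k x) + a k x)).
  - intros k. change (a k (x + h) - a k x + a k x = a k (x + h)). ring.
  - now apply (ex_series_plus (V := R_NormedModule)). }
assert (Hsr : ex_series (fun k => a k (x + h) - a k x - h * d k)).
{ apply (ex_series_minus (V := R_NormedModule) (fun k => a k (x + h) - a k x)).
  - exact Hdiff.
  - now apply (ex_series_scal_l h d). }
replace (Series (fun k => a k (x + h)) - Series (fun k => a k x) - h * Series d)
  with (Series (fun k => a k (x + h) - a k x - h * d k)).
2:{ rewrite Series_minus, Series_minus, Series_scal_l; auto.
    now apply (ex_series_scal_l h d). }
rewrite (Series_incr_n _ (S N)) by (lia || exact Hsr). simpl Nat.pred.
eapply Rle_trans; [apply Rabs_triang | ].
replace (eps * Rabs h) with (eps / 2 * Rabs h + eps / 2 * Rabs h) by field.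
apply Rplus_le_compat.
- replace (sum_f_R0 (fun k => a k (x + h) - a k x - h * d k) N) with
    (sum_f_R0 (fun k => a k (x + h)) N - sum_f_R0 (fun k => a k x) N - h * sum_f_R0 d N).
  + exact Hd'.
  + rewrite !minus_sum. f_equal. rewrite scal_sum. apply sum_eq. intros; ring.
- assert (HsMN : ex_series (fun k => M (S N + k)%nat)) by now apply ex_series_incr_n.
  eapply Rle_trans.
  + apply Series_abs_le with (b := fun k => (2 * Rabs h) * M (S N + k)%nat).
    * intros k. set (j := (S N + k)%nat).
      unfold Rminus at 1. eapply Rle_trans; [apply Rabs_triang | ].
      rewrite Rabs_Ropp, Rabs_mult.
      assert (H1 := HM j h Hh1). assert (H2 := HdM j).
      assert (H3 := Rabs_pos h). nra.
    * now apply (ex_series_scal_l (2 * Rabs h) (fun k => M (S N + k)%nat)).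
  + rewrite Series_scal_l. assert (H3 := Rabs_pos h). nra.
Qed.

(** Common bound for both series: the Lipschitz constant 6 (k + 1) of 1/Gamma at k + 1
    times the modulus of the exponential series term.  The derivative of the Wright
    series is controlled by the same sequence shifted by one. *)
Definition majorant (x : R) (k : nat) : R := 6 * INR (S k) * (Rabs x ^ k / INR (fact k)).

(** With k + 1 <= 2^k it is dominated by the exponential series at 2 |x|. *)
Lemma ex_series_majorant x : ex_series (majorant x).
Proof.
apply ex_series_Rabs_le with (fun k => 6 * ((2 * Rabs x) ^ k * / INR (fact k))).
- intros k. unfold majorant.
  assert (Hf : 0 < / INR (fact k)) by apply Rinv_0_lt_compat, INR_fact_lt_0.
  assert (Hp : 0 <= Rabs x ^ k) by apply pow_le, Rabs_pos.
  assert (Hk : INR (S k) <= 2 ^ k).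
  { clear. induction k as [ | k IH]; [simpl; lra | ].
    rewrite S_INR. simpl (2 ^ S k). rewrite S_INR in IH |- *.
    assert (1 <= 2 ^ k) by (apply pow_R1_Rle; lra). lra. }
  assert (0 <= INR (S k)) by apply pos_INR.
  assert (0 <= Rabs x ^ k * / INR (fact k)) by (apply Rmult_le_pos; lra).
  unfold Rdiv. rewrite Rpow_mult_distr.
  rewrite Rabs_pos_eq by (apply Rmult_le_pos; [lra | assumption]).
  rewrite !Rmult_assoc. apply Rmult_le_compat_l; [lra | ].
  now apply Rmult_le_compat_r.
- apply (ex_series_scal_l 6 (fun k => (2 * Rabs x) ^ k * / INR (fact k))).
  exists (exp (2 * Rabs x)).
  assert (H := is_exp_Reals (2 * Rabs x)). apply is_pseries_R in H.
  apply (is_series_ext (fun k => / INR (fact k) * (2 * Rabs x) ^ k)); [ | exact H].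
  intros k. apply Rmult_comm.
Qed.

Definition bessel_term (x : R) (k : nat) (nu : R) : R :=
  x ^ k / INR (fact k) * rGamma (nu + INR k + 1).

(** The entire factor of I_nu (2 sqrt x), that is, (sqrt x)^(-nu) I_nu (2 sqrt x). *)
Definition bessel_sum (x nu : R) : R := Series (fun k => bessel_term x k nu).

Lemma ex_series_bessel_term x nu : Rabs nu < 1 -> ex_series (fun k => bessel_term x k nu).
Proof.
intros Hnu. apply Rabs_def2 in Hnu.
apply ex_series_Rabs_le with (2 := ex_series_majorant x).
intros k. unfold bessel_term, majorant.
assert (0 <= INR k) by apply pos_INR. rewrite S_INR.
assert (B := rGamma_bounds (nu + INR k + 1) ltac:(lra)).
assert (Hf : 0 < / INR (fact k)) by apply Rinv_0_lt_compat, INR_fact_lt_0.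
assert (Hp : 0 <= Rabs x ^ k) by apply pow_le, Rabs_pos.
unfold Rdiv. rewrite !Rabs_mult, <- RPow_abs, (Rabs_pos_eq (/ _)), (Rabs_pos_eq (rGamma _)) by lra.
rewrite Rmult_comm. apply Rmult_le_compat_r; [apply Rmult_le_pos; lra | lra].
Qed.

(** Shifted so that index k belongs to term k of the Bessel series, where 1/Gamma is
    evaluated at k + 1. *)
Definition rGamma_deriv (k : nat) : R := Derive rGamma (INR (S k)).

Lemma is_derive_rGamma_affine (p q : R) (s0 : R) (n : nat) :
  p * s0 + q = INR (S n) ->
  is_derive (fun s => rGamma (p * s + q)) s0 (p * rGamma_deriv n).
Proof.
intros E.
apply (is_derive_comp rGamma (fun s => p * s + q) s0 (rGamma_deriv n) p).
- rewrite E. apply Derive_correct, ex_derive_rGamma_nat.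
- auto_derive; [exact I | ring].
Qed.

Lemma is_derive_bessel_sum x :
  ex_series (fun k => x ^ k / INR (fact k) * rGamma_deriv k) /\
  is_derive (bessel_sum x) 0 (Series (fun k => x ^ k / INR (fact k) * rGamma_deriv k)).
Proof.
apply (is_derive_Series (bessel_term x) _ (majorant x) 0 1).
- lra.
- intros k. unfold bessel_term.
  apply (is_derive_scal (fun nu => rGamma (nu + INR k + 1)) 0 (x ^ k / INR (fact k))).
  rewrite <- (Rmult_1_l (rGamma_deriv k)).
  apply (is_derive_ext (fun nu => rGamma (1 * nu + (INR k + 1)))).
  { intros nu. f_equal. ring. }
  apply is_derive_rGamma_affine. rewrite S_INR. ring.
- intros k h Hh. apply Rabs_def2 in Hh. unfold bessel_term, majorant.
  assert (Hk : 0 <= INR k) by apply pos_INR.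
  assert (H := rGamma_lipschitz_nat k (0 + h + INR k + 1) ltac:(lra)).
  rewrite <- Rmult_minus_distr_l, Rabs_mult.
  replace (0 + INR k + 1) with (INR (S k)) by (rewrite S_INR; ring).
  replace (0 + h + INR k + 1 - INR (S k)) with h in H by (rewrite S_INR; ring).
  rewrite Rabs_div by apply INR_fact_neq_0.
  rewrite <- RPow_abs, (Rabs_pos_eq (INR (fact k))) by apply pos_INR.
  rewrite (Rmult_comm (6 * _)), Rmult_assoc.
  apply Rmult_le_compat_l; [ | exact H].
  apply Rdiv_le_0_compat; [apply pow_le, Rabs_pos | apply INR_fact_lt_0].
- apply ex_series_majorant.
- apply ex_series_bessel_term. rewrite Rabs_R0. lra.
Qed.

Lemma is_derive_Wi x :
  is_derive (fun alpha => Wi alpha 1 x) 1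
    (Series (fun k => x ^ (S k) / INR (fact (S k)) * rGamma_deriv (S k))).
Proof.
unfold Wi.
eapply proj2, (is_derive_Series
  (fun k alpha => x ^ (S k) / (INR (S k) * INR (fact (S k)))
                  * rGamma (alpha * INR (S k) + 1))
  _ (fun k => majorant x (S k)) 1 1).
- lra.
- intros k.
  assert (Hk : INR (S k) <> 0) by (apply not_0_INR; lia).
  replace (x ^ S k / INR (fact (S k)) * rGamma_deriv (S k)) with
    (x ^ S k / (INR (S k) * INR (fact (S k))) * (INR (S k) * rGamma_deriv (S k)))
    by (field; split; [apply INR_fact_neq_0 | exact Hk]).
  apply (is_derive_scal (fun alpha => rGamma (alpha * INR (S k) + 1))).
  apply (is_derive_ext (fun alpha => rGamma (INR (S k) * alpha + 1))).
  { intros alpha. f_equal. ring. }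
  apply is_derive_rGamma_affine. rewrite (S_INR (S k)). ring.
- intros k h Hh. apply Rabs_def2 in Hh. unfold majorant.
  assert (Hk : 0 < INR (S k)) by (apply lt_0_INR; lia).
  assert (H := rGamma_lipschitz_nat (S k) ((1 + h) * INR (S k) + 1) ltac:(nra)).
  rewrite <- Rmult_minus_distr_l, Rabs_mult.
  replace (1 * INR (S k) + 1) with (INR (S (S k))) by (rewrite (S_INR (S k)); ring).
  replace ((1 + h) * INR (S k) + 1 - INR (S (S k))) with (INR (S k) * h) in H
    by (rewrite (S_INR (S k)); ring).
  rewrite Rabs_mult, (Rabs_pos_eq (INR (S k))) in H by lra.
  rewrite Rabs_div by (apply Rmult_integral_contrapositive_currified;
    [lra | apply INR_fact_neq_0]).
  rewrite <- RPow_abs, Rabs_mult, !(Rabs_pos_eq (INR _)) by apply pos_INR.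
  assert (Hf := INR_fact_lt_0 (S k)).
  replace (6 * INR (S (S k)) * (Rabs x ^ S k / INR (fact (S k))) * Rabs h) with
    (Rabs x ^ S k / (INR (S k) * INR (fact (S k)))
     * (6 * INR (S (S k)) * (INR (S k) * Rabs h))) by (field; lra).
  apply Rmult_le_compat_l; [ | exact H].
  apply Rdiv_le_0_compat; [apply pow_le, Rabs_pos | now apply Rmult_lt_0_compat].
- apply (ex_series_incr_1 (majorant x)), ex_series_majorant.
- apply ex_series_Rabs_le with (fun k => majorant x (S k)).
  + intros k. unfold majorant.
    assert (Hk : 1 <= INR (S k)) by (apply (le_INR 1); lia).
    assert (Hf := INR_fact_lt_0 (S k)).
    assert (B := rGamma_bounds (1 * INR (S k) + 1) ltac:(lra)).
    assert (Hp : 0 <= Rabs x ^ S k) by apply pow_le, Rabs_pos.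
    rewrite Rabs_mult, (Rabs_pos_eq (rGamma _)) by lra.
    rewrite Rabs_div by nra.
    rewrite <- RPow_abs, (Rabs_pos_eq (_ * _)) by nra.
    replace (Rabs x ^ S k / (INR (S k) * INR (fact (S k)))) with
      (/ INR (S k) * (Rabs x ^ S k / INR (fact (S k)))) by (field; lra).
    assert (H0 : 0 <= Rabs x ^ S k / INR (fact (S k))) by (now apply Rdiv_le_0_compat).
    rewrite (S_INR (S k)).
    assert (Hi : / INR (S k) <= 1) by (rewrite <- Rinv_1; apply Rinv_le_contravar; lra).
    assert (Hi0 : 0 < / INR (S k)) by (apply Rinv_0_lt_compat; lra).
    rewrite Rmult_comm, <- Rmult_assoc.
    apply Rmult_le_compat_r; [exact H0 | ]. nra.
  + apply (ex_series_incr_1 (majorant x)), ex_series_majorant.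
Qed.

(** The constant term is the derivative of 1/Gamma at 1, and what follows is the
    derivative found for the Wright series. *)
Lemma bessel_derivative_split x :
  Series (fun k => x ^ k / INR (fact k) * rGamma_deriv k) =
  euler_gamma + Series (fun k => x ^ (S k) / INR (fact (S k)) * rGamma_deriv (S k)).
Proof.
rewrite Series_incr_1.
- f_equal. unfold rGamma_deriv. simpl.
  rewrite (is_derive_unique _ _ _ is_derive_rGamma_1). field.
- apply is_derive_bessel_sum.
Qed.

(** * The Bessel functions at 2 sqrt x *)

Lemma Cexp_plus w z : Cexp (w + z) = (Cexp w * Cexp z)%C.
Proof.
destruct w as [a b], z as [c d].
unfold Cexp, Cplus, Cmult, Re, Im. simpl. rewrite exp_plus, cos_plus, sin_plus.
f_equal; ring.
Qed.

Lemma Cmod_Cexp w : Cmod (Cexp w) = exp (Re w).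
Proof.
unfold Cmod.
replace (fst (Cexp w) ^ 2 + snd (Cexp w) ^ 2) with (Rsqr (exp (Re w))).
- apply sqrt_Rsqr, Rlt_le, exp_pos.
- transitivity (Rsqr (exp (Re w)) * (Rsqr (sin (Im w)) + Rsqr (cos (Im w)))).
  + rewrite sin2_cos2. ring.
  + unfold Rsqr. simpl. ring.
Qed.

(** The bound 0 <= Im w suffices here: Im (Clog x) is 0 or PI for real x, and
    halving it stays in range.  It keeps the sign test of [Carg] on its nonnegative branch. *)
Lemma Clog_Cexp w : 0 <= Im w <= PI -> Clog (Cexp w) = w.
Proof.
intros Hw. unfold Clog, Carg. rewrite Cmod_Cexp, ln_exp.
assert (He := exp_pos (Re w)).
assert (Hs := sin_ge_0 (Im w) ltac:(lra) ltac:(lra)).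
destruct (Rlt_dec (Im (Cexp w)) 0) as [Hi | Hi].
- simpl in Hi. nra.
- replace (Re (Cexp w) / exp (Re w)) with (cos (Im w)) by (simpl; field; lra).
  rewrite acos_cos by exact Hw. now destruct w.
Qed.

Lemma RtoC_is_Cexp x : x <> 0 -> exists L, 0 <= Im L <= PI /\ Cexp L = RtoC x.
Proof.
intros Hx. assert (HPI := PI_RGT_0).
destruct (Rlt_dec 0 x) as [Hp | Hn].
- exists (ln x, 0). split; [simpl; lra | ].
  unfold Cexp, RtoC. simpl. rewrite exp_ln, cos_0, sin_0 by exact Hp.
  f_equal; ring.
- exists (ln (- x), PI). split; [simpl; lra | ].
  unfold Cexp, RtoC. simpl. rewrite exp_ln, cos_PI, sin_PI by lra.
  f_equal; ring.
Qed.

(** Partial sums are real, and a neighbourhood in C contains a product of neighbourhoods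
    of the two coordinates. *)
Lemma CSeries_RtoC (a : nat -> R) :
  ex_series a -> CSeries (fun k => RtoC (a k)) = RtoC (Series a).
Proof.
intros Ha.
apply (iota_filterlim_locally (V := C_R_CompleteNormedModule)).
apply (filterlim_ext (fun n => (sum_n a n, 0) : C)).
{ induction x as [ | n IH].
  - now rewrite !sum_O.
  - rewrite !sum_Sn, <- IH. unfold plus. simpl. unfold RtoC.
    unfold Cplus. simpl. now rewrite Rplus_0_r. }
apply (filterlim_filter_le_2 (G := filter_prod (locally (Series a)) (locally 0))).
2: { apply filterlim_pair; [ | apply filterlim_const].
     exact (Series_correct a Ha). }
intros P [eps HP].
apply Filter_prod with (Q := ball (Series a) eps) (R := ball 0 eps);
  [apply locally_ball | apply locally_ball | ].
intros u v Hu Hv. apply HP. now split.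
Qed.

Lemma Cmult_RtoC_r (u v r : R) : ((u, v) * r)%C = (u * r, v * r).
Proof. unfold Cmult, RtoC. simpl. f_equal; ring. Qed.

Lemma BesselI_sqrt (L : C) (x nu : R) :
  0 <= Im L <= PI -> Cexp L = RtoC x -> Rabs nu < 1 ->
  BesselI nu (2 * Csqrt x) =
  (exp (nu * (Re L / 2)) * cos (nu * (Im L / 2)) * bessel_sum x nu,
   exp (nu * (Re L / 2)) * sin (nu * (Im L / 2)) * bessel_sum x nu).
Proof.
intros HL Ex Hnu.
set (w := (Re L / 2, Im L / 2) : C).
assert (Esqrt : Csqrt x = Cexp w).
{ unfold Csqrt, Crpower. rewrite <- Ex, Clog_Cexp by exact HL.
  f_equal. unfold w, Cmult, RtoC, Re, Im. simpl. f_equal; field. }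
assert (Esq : ((2 * Csqrt x) ^ 2 / 4)%C = RtoC x).
{ rewrite Esqrt, <- Ex.
  replace L with (w + w)%C.
  - rewrite Cexp_plus. simpl. field.
  - destruct L. unfold w, Cplus, Re, Im. simpl. f_equal; field. }
unfold BesselI. rewrite Esq.
replace (2 * Csqrt x / 2)%C with (Cexp w) by (rewrite Esqrt; field).
unfold Crpower. rewrite Clog_Cexp by (unfold w; simpl; lra).
replace (CSeries _) with (RtoC (bessel_sum x nu)).
- replace (nu * w)%C with ((nu * (Re L / 2), nu * (Im L / 2)) : C).
  + unfold Cexp. simpl. apply Cmult_RtoC_r.
  + unfold w, Cmult, RtoC, Re, Im. simpl. f_equal; ring.
- symmetry.
  unfold bessel_sum. rewrite <- CSeries_RtoC by now apply ex_series_bessel_term.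
  f_equal. apply FunctionalExtensionality.functional_extensionality. intros k.
  rewrite <- RtoC_pow, <- RtoC_mult. f_equal. unfold bessel_term. field.
  apply INR_fact_neq_0.
Qed.

Lemma is_derive_slope_lim (h : R -> R) (l : R) :
  is_derive h 0 l -> h 0 = 0 -> is_lim (fun t => h t / t) 0 l.
Proof.
intros Hd H0. apply is_derive_Reals in Hd.
apply is_lim_spec. intros eps.
destruct (Hd eps (cond_pos eps)) as [delta Hdelta].
exists delta. intros t Bt Ht. change (Rabs (t - 0) < delta) in Bt.
rewrite Rminus_0_r in Bt. specialize (Hdelta t Ht Bt).
now rewrite Rplus_0_l, H0, Rminus_0_r in Hdelta.
Qed.

Lemma sin_PI_neq_0 nu : Rabs nu < 1 -> nu <> 0 -> sin (nu * PI) <> 0.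
Proof.
intros Hnu Hn. assert (HPI := PI_RGT_0). apply Rabs_def2 in Hnu.
destruct (Rlt_dec 0 nu) as [Hp | Hm].
- apply Rgt_not_eq, sin_gt_0; nra.
- apply Rlt_not_eq, sin_lt_0_var; nra.
Qed.

(** Numerator and denominator both vanish at 0, so the quotient tends to the ratio of
    their derivatives, PI/2 (- 2 l) and PI. *)
Lemma reflection_quotient_lim (h : R -> R) (l : R) :
  is_derive h 0 l ->
  is_lim (fun nu => PI / 2 * (h (- nu) - h nu) / sin (nu * PI)) 0 (- l).
Proof.
intros Hd. assert (HPI := PI_RGT_0).
assert (Hn : is_derive (fun nu => PI / 2 * (h (- nu) - h nu)) 0 (PI / 2 * (- l - l))).
{ apply (is_derive_scal (fun nu => h (- nu) - h nu) 0 (PI / 2)).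
  apply (is_derive_minus (fun nu => h (- nu)) h); [ | exact Hd].
  replace (- l) with (-1 * l) by ring.
  apply (is_derive_comp h Ropp 0 l (-1)).
  - now rewrite Ropp_0.
  - auto_derive; [exact I | ring]. }
assert (Hs : is_derive (fun nu => sin (nu * PI)) 0 PI).
{ auto_derive; [exact I | ]. rewrite Rmult_0_l, cos_0. ring. }
apply is_derive_slope_lim in Hn; [ | rewrite Ropp_0; ring].
apply is_derive_slope_lim in Hs; [ | now rewrite Rmult_0_l, sin_0].
assert (H := is_lim_div _ _ _ _ _ Hn Hs
  ltac:(intros E; injection E; lra) ltac:(exact I)).
replace (Finite (- l)) with (Rbar_div (PI / 2 * (- l - l)) PI)
  by (simpl; f_equal; field; lra).
apply (is_lim_ext_loc (fun nu =>
  PI / 2 * (h (- nu) - h nu) / nu / (sin (nu * PI) / nu))); [ | exact H].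
exists (mkposreal 1 Rlt_0_1). intros nu Bnu Hnu.
change (Rabs (nu - 0) < 1) in Bnu. rewrite Rminus_0_r in Bnu.
field. split; [now apply sin_PI_neq_0 | exact Hnu].
Qed.

(** The denominator sin (nu PI) is real, so the limit is taken separately in the
    real and imaginary parts u and v of I_nu. *)
Lemma BesselK_0_sqrt (L : C) (x S' : R) :
  0 <= Im L <= PI -> Cexp L = RtoC x ->
  is_derive (bessel_sum x) 0 S' ->
  BesselK 0 (2 * Csqrt x) =
  (- (Re L / 2 * bessel_sum x 0 + S'), - (Im L / 2 * bessel_sum x 0)).
Proof.
intros HL Ex HS. unfold BesselK.
destruct (Req_EM_T 0 (IZR (Int_part 0))) as [_ | Hne].
2:{ exfalso. apply Hne. change 0 with (INR 0) at 2. now rewrite Int_part_INR. }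
assert (ExS : ex_derive (bessel_sum x) 0) by now exists S'.
assert (ES : Derive (fun nu : R => bessel_sum x nu) 0 = S') by now apply is_derive_unique.
assert (Hproper : ProperFilter' (locally' 0))
  by apply (Proper_StrongProper _ (Rbar_locally'_filter 0)).
apply (iota_filterlim_locally (V := C_R_CompleteNormedModule)).
set (u := fun nu => exp (nu * (Re L / 2)) * cos (nu * (Im L / 2)) * bessel_sum x nu).
set (v := fun nu => exp (nu * (Re L / 2)) * sin (nu * (Im L / 2)) * bessel_sum x nu).
assert (Hu : is_derive u 0 (Re L / 2 * bessel_sum x 0 + S')).
{ unfold u. auto_derive; [exact ExS | ].
  rewrite ES, !Rmult_0_l, exp_0, cos_0, sin_0. field. }
assert (Hv : is_derive v 0 (Im L / 2 * bessel_sum x 0)).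
{ unfold v. auto_derive; [exact ExS | ].
  rewrite ES, !Rmult_0_l, exp_0, cos_0, sin_0. field. }
apply (filterlim_ext_loc (fun nu =>
  (PI / 2 * (u (- nu) - u nu) / sin (nu * PI),
   PI / 2 * (v (- nu) - v nu) / sin (nu * PI)) : C)).
{ exists (mkposreal 1 Rlt_0_1). intros nu Bnu Hnu.
  change (Rabs (nu - 0) < 1) in Bnu. rewrite Rminus_0_r in Bnu.
  assert (Hsin := sin_PI_neq_0 nu Bnu Hnu).
  unfold BesselK_quotient.
  rewrite !(BesselI_sqrt L x) by (auto; now rewrite Rabs_Ropp).
  fold (u nu) (v nu) (u (- nu)) (v (- nu)).
  unfold Cdiv. rewrite <- RtoC_inv by exact Hsin.
  unfold Cmult, Cminus, Cplus, Copp, RtoC. simpl. f_equal; field; exact Hsin. }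
apply (filterlim_filter_le_2
  (G := filter_prod (locally (- (Re L / 2 * bessel_sum x 0 + S')))
                    (locally (- (Im L / 2 * bessel_sum x 0))))).
2: { apply filterlim_pair; now apply (reflection_quotient_lim _ _). }
intros P [eps HP].
eapply Filter_prod; [eapply locally_ball | eapply locally_ball | ].
intros a b Ha Hb. apply HP. now split; [apply Ha | apply Hb].
Qed.

Theorem theorem3p3 (x : R) (hx : x <> 0) :
  exists d : R,
    is_derive (fun alpha : R => Wi alpha 1 x) 1 d /\
    RtoC d = (- euler_gamma
              - 1 / 2 * Clog x * BesselI 0 (2 * Csqrt x)
              - BesselK 0 (2 * Csqrt x))%C.
Proof.
eexists. split; [apply is_derive_Wi | ].
destruct (RtoC_is_Cexp x hx) as [L [HL Ex]].
destruct (is_derive_bessel_sum x) as [_ HS].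
rewrite (BesselK_0_sqrt L x _ HL Ex HS), bessel_derivative_split.
rewrite (BesselI_sqrt L x 0 HL Ex) by (rewrite Rabs_R0; lra).
rewrite !Rmult_0_l, exp_0, cos_0, sin_0.
rewrite <- Ex, Clog_Cexp by exact HL.
unfold Cdiv. rewrite <- RtoC_inv by lra.
unfold Cmult, Cminus, Cplus, Copp, RtoC, Re, Im. simpl. f_equal; field.
Qed.
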